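(* Let $m$ and $n$ be positive integers, and let $\{L_{m,k} : k=0,1,2,\ldots\}$ denote the sequence of $m$-Lucas numbers. For an integer $\ell$, let $\hat{Q}_3(m,-m,n,\ell)$ be the closure of the $3$-strand braid $(\sigma_1^{m}\sigma_2^{-m})^n(\sigma_1\sigma_2)^{3\ell}$, and let $\hat{W}_3(m,n) = \hat{Q}_3(m,-m,n,0)$. Then $$\det(\hat{W}_3(m,n)) = L_{m,2n} - 2,$$ and, for both choices of sign, $$\det(\hat{Q}_3(m,-m,n,\pm1)) = L_{m,2n} + 2.$$
   Context: $B_3 = \langle \sigma_1,\sigma_2 \mid \sigma_1\sigma_2\sigma_1 = \sigma_2\sigma_1\sigma_2\rangle$ is the Artin braid group on $3$ strands, with $\sigma_1,\sigma_2$ the standard generators; the closure of a braid $\beta\in B_3$ is the knot or link formed by closing $\beta$ in the usual way. For a knot or link $K$, its determinant is $\det(K) = \vert\Delta_K(-1)\vert$, where $\Delta_K(t)$ is the (one-variable) Alexander polynomial of $K$, defined up to multiplication by $\pm t^k$, $k\in\mathbb{Z}$. For a positive integer $m$, the $m$-Lucas numbers are given by $L_{m,k} = \Phi_m^k + (-\Phi_m^{-1})^k$ for $k = 0,1,2,\ldots$, where $\Phi_m = \frac{m+\sqrt{m^2+4}}{2}$. The link $\hat{W}_3(m,n)$ is called a hybrid weaving knot. *)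

(* Defs.v *)
From HB Require Import structures.
From mathcomp Require Import all_boot all_order perm all_algebra.
From mathcomp Require Import boolp classical_sets reals.

Set Implicit Arguments.
Unset Strict Implicit.
Unset Printing Implicit Defensive.

Import Order.TTheory GRing.Theory Num.Theory.

Local Open Scope ring_scope.

(* [(i, true)] is sigma_{i+1} and [(i, false)] is its inverse, for i in {0, 1}. *)
Definition letter := ('I_2 * bool)%type.
Definition word := seq letter.

Definition s1 : letter := (ord0, true).
Definition s2 : letter := (ord_max, true).

(* The congruence of the presentation < s1, s2 | s1 s2 s1 = s2 s1 s2 >. *)
Inductive braid_eq : word -> word -> Prop :=
| braid_refl u : braid_eq u u
| braid_sym u v : braid_eq u v -> braid_eq v u
| braid_trans u v w : braid_eq u v -> braid_eq v w -> braid_eq u w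
| braid_cat u u' v v' :
    braid_eq u u' -> braid_eq v v' -> braid_eq (u ++ v) (u' ++ v')
| braid_cancel i s : braid_eq [:: (i, s); (i, ~~ s)] [::]
| braid_artin : braid_eq [:: s1; s2; s1] [:: s2; s1; s2].

Definition braid_eqb (u v : word) : bool := `[< braid_eq u v >].

Fact braid_eqb_refl : reflexive braid_eqb.
Proof. by move=> u; apply/asboolP; exact: braid_refl. Qed.

Fact braid_eqb_sym : symmetric braid_eqb.
Proof. by move=> u v; apply/asboolP/asboolP; exact: braid_sym. Qed.

Fact braid_eqb_trans : transitive braid_eqb.
Proof.
move=> v u w /asboolP uv /asboolP vw.
by apply/asboolP; exact: braid_trans uv vw.
Qed.

Canonical braid_equiv :=
  EquivRel braid_eqb braid_eqb_refl braid_eqb_sym braid_eqb_trans.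

Definition B3 : Type := {eq_quot braid_equiv}%qT.
HB.instance Definition _ := Choice.on B3.

Definition braid_of_word (w : word) : B3 := \pi_({eq_quot braid_equiv})%qT w.

Definition inv_word (w : word) : word := rev [seq (l.1, ~~ l.2) | l <- w].

Definition B3_one : B3 := braid_of_word [::].
Definition B3_mul (a b : B3) : B3 :=
  braid_of_word (repr (a : {eq_quot braid_equiv}%qT)
                 ++ repr (b : {eq_quot braid_equiv}%qT)).
Definition B3_inv (a : B3) : B3 :=
  braid_of_word (inv_word (repr (a : {eq_quot braid_equiv}%qT))).

Lemma braid_of_wordP u v : braid_of_word u = braid_of_word v <-> braid_eq u v.
Proof.
split=> [/eqmodP /asboolP // | uv].
by apply/eqmodP/asboolP.
Qed.

Lemma braid_of_word_repr (a : B3) :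
  braid_of_word (repr (a : {eq_quot braid_equiv}%qT)) = a.
Proof. exact: reprK. Qed.

Lemma repr_braid_of_word u :
  braid_eq (repr (braid_of_word u : {eq_quot braid_equiv}%qT)) u.
Proof. by apply/braid_of_wordP; rewrite braid_of_word_repr. Qed.

Lemma braid_of_word_cat u v :
  braid_of_word (u ++ v) = B3_mul (braid_of_word u) (braid_of_word v).
Proof.
by apply/braid_of_wordP/braid_sym; apply: braid_cat; exact: repr_braid_of_word.
Qed.

Lemma inv_word_cat u v : inv_word (u ++ v) = inv_word v ++ inv_word u.
Proof. by rewrite /inv_word map_cat rev_cat. Qed.

Lemma inv_wordK : involutive inv_word.
Proof.
move=> w; rewrite /inv_word map_rev revK -map_comp.
by rewrite -[RHS]map_id; apply: eq_map => -[i s] /=; rewrite negbK.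
Qed.

Lemma braid_mul_inv_word w : braid_eq (w ++ inv_word w) [::].
Proof.
elim: w => [|[i s] w IHw]; first exact: braid_refl.
rewrite -cat1s inv_word_cat -catA (catA w).
apply: braid_trans (braid_cancel i s).
rewrite -[X in braid_eq _ X]cat1s; apply: braid_cat; first exact: braid_refl.
by apply: (braid_cat (u' := [::])) IHw _; exact: braid_refl.
Qed.

Fact B3_mulA : associative B3_mul.
Proof.
move=> a b c; rewrite -(braid_of_word_repr a) -(braid_of_word_repr b).
by rewrite -(braid_of_word_repr c) -!braid_of_word_cat catA.
Qed.

Fact B3_mul1g : left_id B3_one B3_mul.
Proof.
by move=> a; rewrite -(braid_of_word_repr a) /B3_one -braid_of_word_cat.
Qed.

Fact B3_mulg1 : right_id B3_one B3_mul.
Proof.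
move=> a; rewrite -(braid_of_word_repr a) /B3_one -braid_of_word_cat.
by rewrite cats0.
Qed.

Fact B3_mulgV : right_inverse B3_one B3_inv B3_mul.
Proof.
move=> a; rewrite -[X in B3_mul X](braid_of_word_repr a) -braid_of_word_cat.
by apply/braid_of_wordP; exact: braid_mul_inv_word.
Qed.

Fact B3_mulVg : left_inverse B3_one B3_inv B3_mul.
Proof.
move=> a; rewrite -[X in B3_mul _ X](braid_of_word_repr a) -braid_of_word_cat.
apply/braid_of_wordP; set w := repr _.
by rewrite -[X in _ ++ X]inv_wordK; exact: braid_mul_inv_word.
Qed.

HB.instance Definition _ :=
  isGroup.Build B3 B3_mulA B3_mul1g B3_mulg1 B3_mulVg B3_mulgV.

Definition sigma1 : B3 := braid_of_word [:: s1].
Definition sigma2 : B3 := braid_of_word [:: s2].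

Definition expgz (G : groupType) (x : G) (z : int) : G :=
  match z with Posz k => (x ^+ k)%g | Negz k => (x ^- k.+1)%g end.

Definition Q3 (m1 m2 : int) (n : nat) (l : int) : B3 :=
  ((expgz sigma1 m1 * expgz sigma2 m2) ^+ n
   * expgz (sigma1 * sigma2) (3 * l)%R)%g.

Definition W3 (m n : nat) : B3 := Q3 m%:Z (- m%:Z) n 0.

(* An oriented link diagram, given by its signed Gauss code.  The link is cut
   into oriented edges, and [next e] follows [e] along the orientation.
   [under e = Some (o, s)] means that, between [e] and [next e], the link passes
   under the edge [o], at a crossing of sign [s] ([true] for positive);
   [under e = None] means that it does not go under anything there: that point
   is an overpass or just a subdivision point, so that components without
   crossings are allowed.  An edge going over a crossing does not go under one
   and goes over only one, so a crossing is a pair (e, o).  Planarity is not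
   imposed. *)
Record diagram := Diagram {
  edge : finType;
  next : edge -> edge;
  under : edge -> option (edge * bool);
  next_inj : injective next;
  under_over : forall e o s, under e = Some (o, s) -> under o = None;
  under_inj : forall e e' o s s',
    under e = Some (o, s) -> under e' = Some (o, s') -> e = e'
}.

(* The strands [i] and [i + 1] at which sigma_{i+1} acts. *)
Definition lstrand (i : 'I_2) : 'I_3 := widen_ord (leqnSn 2) i.
Definition rstrand (i : 'I_2) : 'I_3 := lift ord0 i.

Lemma lr_strand i : lstrand i != rstrand i.
Proof. by rewrite -val_eqE /= /bump /= add1n neq_ltn ltnSn. Qed.

Section Closure.
Variable w : word.

(* The edge [(k, i)] is the strand in position [i] after the first [k] letters.
   [ordS] sends the last level back to level 0: this closes the braid up. *)
Definition cl_edge := ('I_(size w).+1 * 'I_3)%type.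

Definition cl_next (e : cl_edge) : cl_edge :=
  (ordS e.1, if onth w e.1 is Some (i, _)
             then tperm (lstrand i) (rstrand i) e.2 else e.2).

(* In sigma_i the strand leaving position i passes over the one leaving
   position i + 1; in its inverse it is the other way round. *)
Definition cl_under (e : cl_edge) : option (cl_edge * bool) :=
  match onth w e.1 with
  | Some (i, true) =>
      if e.2 == rstrand i then Some ((e.1, lstrand i), true) else None
  | Some (i, false) =>
      if e.2 == lstrand i then Some ((e.1, rstrand i), false) else None
  | None => None
  end.

Fact cl_next_inj : injective cl_next.
Proof.
move=> [k a] [k' b]; rewrite /cl_next /= => E.
have Ek : k = k' by apply: (@ordS_inj (size w).+1); exact: (congr1 fst E).
subst k'; move/(congr1 snd): E => /=.
by case: (onth _ _) => [[i _] /perm_inj ->|->].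
Qed.

Fact cl_under_over e o s : cl_under e = Some (o, s) -> cl_under o = None.
Proof.
rewrite /cl_under; case E: (onth w e.1) => [[i []]|] //.
  by case: ifP => // _ [<- _] /=; rewrite E (negPf (lr_strand i)).
by case: ifP => // _ [<- _] /=; rewrite E eq_sym (negPf (lr_strand i)).
Qed.

Fact cl_under_inj e e' o s s' :
  cl_under e = Some (o, s) -> cl_under e' = Some (o, s') -> e = e'.
Proof.
case: e e' => [k a] [k' b]; rewrite /cl_under /=.
case E: (onth w k) => [[i []]|] //; case: eqP => // -> [<- _];
case E': (onth w k') => [[j []]|] //; case: eqP => // -> [F1 F2 _];
by move: E'; rewrite F1 E => -[->] //.
Qed.

Definition closure_diagram : diagram :=
  Diagram cl_next_inj cl_under_over cl_under_inj.

End Closure.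

(* [K] is the closure of the braid [b], drawn from any word representing [b]. *)
Definition is_closure (b : B3) (K : diagram) : Prop :=
  exists2 w : word, braid_of_word w = b & K = closure_diagram w.

Section Alexander.
Variable K : diagram.

(* The Wirtinger presentation of the link group has one generator per edge and
   one relation [u = v] per edge [e] between positive words in the generators;
   [o * e' = e * o] and [e' * o = o * e] conjugate [e] by the overpass [o]. *)
Definition wirtinger (e : edge K) : seq (edge K) * seq (edge K) :=
  let e' := next e in
  match under e with
  | Some (o, true) => ([:: e'; o], [:: o; e])
  | Some (o, false) => ([:: o; e'], [:: e; o])
  | None => ([:: e'], [:: e])
  end.

(* The Fox derivative of a positive word with respect to the generator [x],
   evaluated by sending every generator to the variable t = 'X. *)
Fixpoint fox (x : edge K) (u : seq (edge K)) : {poly int} :=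
  if u is y :: u' then (y == x)%:R + 'X * fox x u' else 0.

(* The relator u v^-1 has abelianized Fox derivative fox x u - fox x v. *)
Definition alexander_mx : 'M[{poly int}]_#|edge K| :=
  \matrix_(i, j) (fox (enum_val j) (wirtinger (enum_val i)).1
                  - fox (enum_val j) (wirtinger (enum_val i)).2).

(* Divisibility in Z[t, t^-1]; as t is a unit there, Laurent polynomials
   are represented, up to units, by elements of Z[t]. *)
Definition laurent_dvd (p q : {poly int}) : Prop :=
  exists k : nat, exists r : {poly int}, q * 'X^k = r * p.

(* A gcd in Z[t, t^-1] of the generators of the first elementary ideal. *)
Definition is_alexander_poly (D : {poly int}) : Prop :=
  forall p : {poly int},
    laurent_dvd p D <->
    (forall i j, laurent_dvd p (\det (row' i (col' j alexander_mx)))).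

(* Such gcds are unique up to units +-t^k; one of them is chosen. *)
Definition alexander_poly : {poly int} := xget 0 [set D | is_alexander_poly D].

Definition link_det : nat := `|alexander_poly.[-1]|%N.

End Alexander.

Definition Phi (R : realType) (m : nat) : R :=
  (m%:R + Num.sqrt (m%:R ^+ 2 + 4)) / 2.

Definition lucas (R : realType) (m k : nat) : R :=
  Phi R m ^+ k + (- (Phi R m)^-1) ^+ k.

(* Main.v *)
Require Import Defs.
From mathcomp Require Import all_boot all_order perm all_algebra.
From mathcomp Require Import boolp classical_sets reals.
From mathcomp Require Import ring lra zify.
Import Order.TTheory GRing.Theory Num.Theory.
Local Open Scope ring_scope.

(* The Alexander matrix of a closed braid kills the all-ones column, and it is
   killed on the left by a row of powers of t, which expresses that the braid
   action preserves the product x1 x2 x3 of the meridians.  Hence all its first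
   minors agree up to units of Z[t, t^-1], and the determinant of the link is
   the absolute value at t = -1 of any one of them.

   At t = -1 the relations are Fox colourings, solved level by level along the
   braid, so that a minor of the big matrix collapses to a 3 x 3 determinant and
   then to det(1 - H), where H is the reduced Burau matrix of the braid at
   t = -1.  As H is in SL_2(Z), this is 2 - tr H.  The full twist acts by -1 and
   sigma1^m sigma2^-m by a matrix of trace m^2 + 2 and determinant 1, with
   eigenvalues Phi_m^2 and Phi_m^-2. *)

(** * Linear algebra *)

(** Replace row [i] of [A] by [v_k e_j - v_j e_k]. The new matrix still kills [v], so it is
    singular, and expanding its determinant along that row gives the identity. *)
Lemma cofactor_ker (R : idomainType) (n : nat) (A : 'M[R]_n) (v : 'cV[R]_n)
    (i j k : 'I_n) :
  v != 0 -> A *m v = 0 -> v k 0 * cofactor A i j = v j 0 * cofactor A i k.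
Proof.
move=> v0 Av0.
pose B := \matrix_(a, b) if a == i then
  v k 0 * (b == j)%:R - v j 0 * (b == k)%:R else A a b.
have Bv0 : B *m v = 0.
  apply/matrixP => a b; rewrite !mxE ord1.
  case: (eqVneq a i) => [->|ai].
    under eq_bigr => l _ do rewrite mxE eqxx mulrBl.
    rewrite sumrB (bigD1 j) //= eqxx big1 => [|l /negPf ->]; last first.
      by rewrite mulr0 mul0r.
    rewrite (bigD1 k) //= eqxx big1 => [|l /negPf ->]; last first.
      by rewrite mulr0 mul0r.
    by rewrite !mulr1 !addr0; ring.
  transitivity ((A *m v) a 0); last by rewrite Av0 mxE.
  by rewrite mxE; apply: eq_bigr => l _; rewrite mxE (negPf ai).
have detB0 : \det B = 0.
  rewrite -det_tr; apply/eqP/det0P; exists v^T; first by rewrite trmx_eq0.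
  by rewrite -trmx_mul Bv0 trmx0.
have cofB l : cofactor B i l = cofactor A i l.
  rewrite /cofactor; congr (_ * \det _); apply/matrixP => a b.
  by rewrite !mxE eq_sym (negPf (neq_lift _ _)).
move: detB0; rewrite (expand_det_row B i).
under eq_bigr => l _ do rewrite cofB mxE eqxx mulrBl.
rewrite sumrB (bigD1 j) //= eqxx big1 => [|l /negPf ->]; last first.
  by rewrite mulr0 mul0r.
rewrite (bigD1 k) //= eqxx big1 => [|l /negPf ->]; last first.
  by rewrite mulr0 mul0r.
by rewrite !mulr1 !addr0 => /subr0_eq.
Qed.

(** Sylvester's identity: two triangular factorisations of the block matrix with rows [1, A] and
    [-B, 1]. *)
Lemma det_add1_mulC (R : comNzRingType) (m n : nat) (A : 'M[R]_(m, n))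
    (B : 'M[R]_(n, m)) :
  \det (1%:M + A *m B) = \det (1%:M + B *m A).
Proof.
have E : block_mx 1%:M 0 (- B) 1%:M *m block_mx 1%:M A 0 (1%:M + B *m A)
         = block_mx (1%:M + A *m B) A 0 1%:M *m block_mx 1%:M 0 (- B) 1%:M.
  rewrite !mulmx_block !mul1mx !mul0mx !mulmx1 !mulmx0 !addr0 !add0r.
  by rewrite mulmxN mulNmx addrK addrCA addNr addr0.
move/(congr1 (@determinant _ _)): E.
by rewrite !det_mulmx !det_lblock !det_ublock !det1 !mul1r !mulr1.
Qed.

Lemma sum_enum_val_pair (n d : nat) (V : nmodType) (F : 'I_n * 'I_d -> V) :
  \sum_(i < #|{: 'I_n * 'I_d}|) F (enum_val i) = \sum_k \sum_a F (k, a).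
Proof.
by rewrite pair_bigA -(big_enum_val (A := {: 'I_n * 'I_d}));
  apply: eq_bigr => -[].
Qed.

(** * Determinants of cyclic linear systems *)

Definition chain {d : nat} (t : seq 'M[int]_d) : 'M[int]_d :=
  foldl (fun Y A => A *m Y) 1%:M t.

Section CyclicDet.
Variables (N d : nat) (s : seq 'M[int]_d) (C : 'M[int]_d).
Hypothesis size_s : size s = N.
Let E : finType := ('I_N.+1 * 'I_d)%type.
Let ofE (F : E -> E -> int) : 'M_#|E| :=
  \matrix_(i, j) F (enum_val i) (enum_val j).

(* The system x_(k+1) = A_k x_k along a cycle, where A_k = nth 1 s k; the last
   level has A_N = 1, and C perturbs the equations for x_0. *)
Definition cyclic_coef (e f : E) : int :=
  (e == f)%:R - (e.1 == ordS f.1)%:R * (nth 1%:M s f.1) e.2 f.2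
  + ((e.1 == ord0) && (f.1 == ord0))%:R * C e.2 f.2.

Let shift_coef (e f : E) : int :=
  (e.1 == f.1.+1 :> nat)%:R * (nth 1%:M s f.1) e.2 f.2.

(** A nonzero entry of the [k]-th power links two levels that differ by exactly [k], and there are
    only [N + 1] levels. *)
Let shift_nilpotent : ofE shift_coef ^+ N.+1 = 0.
Proof.
suff H k i j : (ofE shift_coef ^+ k) i j != 0 ->
    val (enum_val i).1 = (val (enum_val j).1 + k)%N.
  apply/matrixP => i j; rewrite [RHS]mxE; apply/eqP/negP => /negP/H /= ij.
  by move: (ltn_ord (enum_val i).1); rewrite ij; lia.
elim: k i j => [|k IHk] i j.
  by rewrite expr0 mxE addn0; have [->|_] := eqVneq i j; rewrite ?mulr0n ?eqxx.
rewrite exprS mxE => ne0.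
have [l] : exists l, ofE shift_coef i l * (ofE shift_coef ^+ k) l j != 0.
  apply/existsP; apply: contraNT ne0; rewrite negb_exists => /forallP h.
  by rewrite big1 // => l _; apply/eqP; have := h l; rewrite negbK.
rewrite mulf_eq0 negb_or => /andP[il /IHk lj].
move: il; rewrite mxE /shift_coef;
case: (eqVneq (val (enum_val i).1)) => [-> _|_]; last by rewrite mul0r eqxx.
by rewrite lj addnS.
Qed.

(** The finite geometric series is an integral inverse, so the determinant is a unit of Z. *)
Let absz_det_shift : `|\det (1%:M - ofE shift_coef)|%N = 1%N.
Proof.
pose S := \sum_(k < N.+1) ofE shift_coef ^+ k.
have LS : (1%:M - ofE shift_coef) *m S = 1%:M.
  apply: oppr_inj; rewrite -mulNmx opprB.
  have := subrX1 (ofE shift_coef) N.+1.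
  by rewrite shift_nilpotent sub0r => /esym.
have : (`|\det (1%:M - ofE shift_coef)| * `|\det S|)%N == 1%N.
  by rewrite -abszM -det_mulmx LS det1.
by rewrite muln_eq1 => /andP[/eqP].
Qed.

(* The matrix is L + U V, with L = 1 - (shift) and U, V of width d.  Solving
   L Y = U gives det (L + U V) = det L * det (1 + V Y). *)
Lemma absz_det_cyclic :
  `|\det (ofE cyclic_coef)|%N = `|\det (1%:M + C - chain s)|%N.
Proof.
(* Block [k] of [Y] is the product of the first [k] matrices: the solution of the recurrence that
   starts from the identity at level 0. *)
pose Y := \matrix_(i < #|E|, c < d)
  chain (take (enum_val i).1 s) (enum_val i).2 c.
pose V := \matrix_(c < d, j < #|E|)
  (((enum_val j).1 == ord0)%:R * C c (enum_val j).2
  - ((enum_val j).1 == ord_max)%:R * (c == (enum_val j).2)%:R).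
pose U : 'M[int]_(#|E|, d) := \matrix_(i < #|E|, c < d)
  (((enum_val i).1 == ord0) && ((enum_val i).2 == c))%:R.
have LY : (1%:M - ofE shift_coef) *m Y = U.
  rewrite mulmxBl mul1mx; apply/matrixP => i c; rewrite !mxE.
  under eq_bigr do rewrite !mxE.
  rewrite (sum_enum_val_pair _ _ _ (fun e => shift_coef _ e *
    chain (take e.1 s) e.2 c)).
  case: (enum_val i) => -[[|k] hk] a /=.
    rewrite take0 mxE big1 ?subr0 // => k _.
    by rewrite big1 // => b _; rewrite /shift_coef /= !mul0r.
  have kN : (k < N.+1)%N by apply: ltnW.
  rewrite (bigD1 (Ordinal kN)) //=.
  rewrite [X in _ - (_ + X)]big1 => [|l lk]; last first.
    rewrite big1 // => b _; rewrite /shift_coef /= eqSS.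
    by move: lk; rewrite -val_eqE /= eq_sym => /negPf ->; rewrite !mul0r.
  rewrite (take_nth 1%:M) ?size_s // /chain foldl_rcons mxE addr0.
  apply/eqP; rewrite subr_eq0; apply/eqP; apply: eq_bigr => b _.
  by rewrite /shift_coef /= eqxx mul1r.
have ME : ofE cyclic_coef = (1%:M - ofE shift_coef) *m (1%:M + Y *m V).
  rewrite mulmxDr mulmx1 mulmxA LY.
  apply/matrixP => i j; rewrite !mxE.
  under [X in _ = _ + X]eq_bigr do rewrite !mxE.
  rewrite /cyclic_coef /shift_coef -(inj_eq enum_val_inj).
  case: (enum_val i) => k a; case: (enum_val j) => l b /=.
  rewrite (bigD1 a) //= eqxx andbT [X in _ + (_ + X)]big1 ?addr0; last first.
    by move=> c /negPf; rewrite eq_sym => ->; rewrite andbF mul0r.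
  have [->|k0] := eqVneq k ord0; last first.
    rewrite mul0r !addr0 /= mul0r addr0; congr (_ - _ * _); congr (_%:R).
    rewrite -val_eqE /=; case: (ltnP l N) => lN; first by rewrite modn_small.
    have -> : l = N :> nat by apply/eqP; rewrite eqn_leq lN -ltnS ltn_ord.
    by move: k0; rewrite -val_eqE modnn => /negPf ->; rewrite ltn_eqF.
  (* Only the last level leads back to level 0; there [nth] returns its default [1%:M], as [s] has
     [N] entries for [N + 1] levels. *)
  suff -> : (ord0 == ordS l)%:R * (nth 1%:M s l) a b =
      (l == ord_max)%:R * (a == b)%:R by rewrite mul0r /=; ring.
  have [->|lN] := eqVneq l ord_max.
    by rewrite -val_eqE /= modnn eqxx nth_default ?size_s // mxE.
  rewrite mul0r -val_eqE /= modn_small ?mul0r // ltnS ltn_neqAle lN.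
  by rewrite -ltnS ltn_ord.
rewrite ME det_mulmx abszM absz_det_shift mul1n det_add1_mulC.
congr (`|\det _|%N); rewrite -addrA; congr (_ + _).
apply/matrixP => a b; rewrite !mxE.
under eq_bigr do rewrite !mxE.
rewrite (sum_enum_val_pair _ _ _ (fun e => ((e.1 == ord0)%:R * C a e.2
  - (e.1 == ord_max)%:R * (a == e.2)%:R) * chain (take e.1 s) e.2 b)).
transitivity (\sum_(k < N.+1) ((k == ord0)%:R * (C *m chain (take k s)) a b
  - (k == ord_max)%:R * chain (take k s) a b)).
  apply: eq_bigr => k _; rewrite mxE big_distrr /=.
  rewrite (eq_bigr (fun c => (k == ord0)%:R * (C a c * chain (take k s) c b) -
    (k == ord_max)%:R * ((a == c)%:R * chain (take k s) c b))); last first.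
    by move=> c _ /=; ring.
  rewrite sumrB -(big_distrr _ _ (fun c => (a == c)%:R * _)) /=.
  congr (_ - _ * _); rewrite (bigD1 a) //= eqxx mul1r big1 ?addr0 // => c.
  by rewrite eq_sym => /negPf ->; rewrite mul0r.
rewrite sumrB (bigD1 ord0) //= big1 => [|k /negPf ->]; last by rewrite mul0r.
rewrite (bigD1 ord_max) //= big1 => [|k /negPf ->]; last by rewrite mul0r.
by rewrite !addr0 /= take0 mulmx1 take_oversize ?size_s ?eqxx ?mul1r.
Qed.
End CyclicDet.
Arguments cyclic_coef {N d} s C e f.
Arguments absz_det_cyclic {N d} s C.

(** * The determinant of a link as a minor *)

Section LinkDet.
Variable K : diagram.

Lemma laurent_dvd_refl p : laurent_dvd p p.
Proof. by exists 0%N, 1; rewrite mulr1 mul1r. Qed.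

Lemma laurent_dvd_trans q p r :
  laurent_dvd p q -> laurent_dvd q r -> laurent_dvd p r.
Proof.
move=> [k [a qE]] [l [b rE]]; exists (l + k)%N, (b * a).
by rewrite exprD mulrA rE -mulrA qE mulrA.
Qed.

(** For [p] nonzero the two quotients multiply to a power of t, so their values at -1 are integers
    with product 1 or -1. *)
Lemma laurent_associate_at_m1 p q : laurent_dvd p q -> laurent_dvd q p ->
  `|p.[-1]|%N = `|q.[-1]|%N.
Proof.
move=> [k [a qE]] [l [b pE]].
have absX (r : {poly int}) m : `|(r * 'X^m).[-1]|%N = `|r.[-1]|%N.
  by rewrite hornerM hornerXn abszM abszX exp1n muln1.
have [p0|p0] := eqVneq p 0.
  by rewrite -(absX q k) qE p0 mulr0.
have ba : b * a = 'X^(l + k).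
  by apply: (mulIf p0); rewrite -mulrA -qE mulrA -pE exprD; ring.
have : (`|b.[-1]| * `|a.[-1]|)%N == 1%N.
  by rewrite -abszM -hornerM ba hornerXn abszX exp1n.
rewrite muln_eq1 => /andP[_ /eqP a1].
by rewrite -(absX q k) qE hornerM abszM a1 mul1n.
Qed.

(** A minor dividing all the others is itself a gcd of them, hence associate to the one chosen by
    [xget]. *)
Lemma link_det_minor (i0 j0 : 'I_#|edge K|) :
  (forall i j, laurent_dvd (\det (row' i0 (col' j0 (alexander_mx K))))
                           (\det (row' i (col' j (alexander_mx K))))) ->
  link_det K = `|(\det (row' i0 (col' j0 (alexander_mx K)))).[-1]|%N.
Proof.
set D := \det _ => Ddvd.
have alexD : is_alexander_poly K D.
  move=> p; split=> [pD i j|/(_ i0 j0)//].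
  exact: laurent_dvd_trans (Ddvd i j).
have alexK : is_alexander_poly K (alexander_poly K).
  exact: (xgetPex 0 (ex_intro (fun D => is_alexander_poly K D) D alexD)).
apply: laurent_associate_at_m1.
  by apply/alexD => i j; apply: (alexK _).1; exact: laurent_dvd_refl.
by apply/alexK => i j; exact: Ddvd.
Qed.

(** Fox's fundamental formula divided by t - 1. The sum depends only on the length of the word, and
    both sides of a Wirtinger relation have the same length. *)
Lemma fox_sum (u : seq (edge K)) :
  \sum_x fox x u = \sum_(k < size u) 'X^k.
Proof.
elim: u => [|y u IHu] /=; first by rewrite big1 ?big_ord0.
rewrite big_split -big_distrr /= IHu.
rewrite (bigD1 y) //= eqxx big1 => [|x]; last first.
  by rewrite eq_sym => /negPf ->.
rewrite big_ord_recl expr0 addr0; congr (_ + _).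
by rewrite big_distrr; apply: eq_bigr => k _; rewrite exprS.
Qed.

Lemma alexander_mx_row_sum : alexander_mx K *m const_mx 1 = 0 :> 'cV_ _.
Proof.
apply/matrixP => i j; rewrite !mxE.
under eq_bigr => k _ do rewrite !mxE mulr1.
rewrite -(big_enum_val (A := edge K) (fun x => fox x _ - fox x _)) /=.
rewrite sumrB !fox_sum /wirtinger.
by case: under => [[o []]|] /=; rewrite subrr.
Qed.
End LinkDet.

(** * Closed braids *)

Lemma val_tperm n (x y z : 'I_n) : val (tperm x y z) =
  if val z == val x then val y else if val z == val y then val x else val z.
Proof. by rewrite permE /= !val_eqE; do 2?case: ifP. Qed.

Definition strand_step (ol : option letter) (i : 'I_3) : 'I_3 :=
  if ol is Some (c, _) then tperm (lstrand c) (rstrand c) i else i.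

(* The coefficients, over the edges j of the same level, of the relation at
   position i, scaled so that the next edge, at position k, has coefficient
   'X^k. *)
Definition wirtinger_src (ol : option letter) (i j : 'I_3) : {poly int} :=
  match ol with
  | Some (c, true) =>
      if i == rstrand c
      then 'X^(lstrand c) * ((1 - 'X) * (lstrand c == j)%:R + 'X * (i == j)%:R)
      else 'X^(strand_step ol i) * (i == j)%:R
  | Some (c, false) =>
      if i == lstrand c
      then 'X^(lstrand c) * ((i == j)%:R + ('X - 1) * (rstrand c == j)%:R)
      else 'X^(strand_step ol i) * (i == j)%:R
  | None => 'X^i * (i == j)%:R
  end.

(** The row 1, t, t^2 consists of the Fox derivatives of x1 x2 x3; its invariance is a finite
    check. *)
Lemma sum_wirtinger_src ol j : \sum_i wirtinger_src ol i j = 'X^j.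
Proof.
rewrite !big_ord_recl big_ord0 /=.
case: ol => [[[[|[|c]] hc] []]|] //; case: j => [[|[|[|j]]] hj] //=;
  rewrite -?val_eqE /= ?val_tperm -?val_eqE /= ?expr0 ?expr1; ring.
Qed.

(** At t = -1 a strand of colour u passing under a strand of colour o leaves with colour 2 o - u,
    for either sign. Here [j] is the position before the crossing. *)
Definition fox_colour_src (l : letter) (j i : 'I_3) : int :=
  let: (u, o) := if l.2 then (rstrand l.1, lstrand l.1)
                 else (lstrand l.1, rstrand l.1) in
  if j == u then 2 * (o == i)%:R - (j == i)%:R else (j == i)%:R.

Definition fox_colour_mx (l : letter) : 'M[int]_3 :=
  \matrix_(i, j) fox_colour_src l (tperm (lstrand l.1) (rstrand l.1) i) j.

Section Closure.
Variable w : word.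
Let K := closure_diagram w.

(* Under a negative crossing the target strand has coefficient 'X in the
   relation, so the weight is one power of 'X lower there. *)
Definition row_weight (e : cl_edge w) : {poly int} :=
  if cl_under e is Some (_, false) then 'X^(e.2) else 'X^((cl_next e).2).

Definition rel_coef (e f : edge K) : {poly int} :=
  fox f (wirtinger e).1 - fox f (wirtinger e).2.

Lemma row_weight_rel_coef (e f : cl_edge w) :
  row_weight e * rel_coef e f = 'X^(f.2) * (cl_next e == f)%:R
     - (e.1 == f.1)%:R * wirtinger_src (onth w e.1) e.2 f.2.
Proof.
have -> : 'X^(f.2) * (cl_next e == f)%:R =
    'X^((cl_next e).2) * (cl_next e == f)%:R :> {poly int}.
  by case: eqP => [<-|]; rewrite ?mulr0.
case: e f => k i [k' j].
have edge_eqE a b c d :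
  ((a, b) == (c, d) :> edge K) = (a == c) && (b == d) by exact: xpair_eqE.
rewrite /row_weight /rel_coef /wirtinger /= -/(cl_next (k, i)).
case E: (cl_next _) => [k1 i1].
have -> : i1 = strand_step (onth w k) i by case: E.
rewrite /cl_under /=; case: (onth w k) => [[c []]|]; last first.
- by rewrite /= xpair_eqE !edge_eqE; case: (_ == k') => /=; ring.
- case: (eqVneq i (lstrand c)) => [->|ic] /=;
    rewrite ?tpermL xpair_eqE !edge_eqE.
    rewrite (_ : 'X^(rstrand c) = 'X^(lstrand c) * 'X); last first.
      by rewrite -exprSr; congr ('X^_); rewrite /= /bump.
    by case: (k == k'); rewrite ?eqxx /=; ring.
  by case: (k == k') => /=; rewrite (negPf ic) /=; ring.
case: (eqVneq i (rstrand c)) => [->|ic] /=; rewrite ?tpermR xpair_eqE !edge_eqE.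
  by case: (k == k') => /=; rewrite ?eqxx /=; ring.
by case: (k == k') => /=; rewrite (negPf ic) /=; ring.
Qed.

(** The edge [f] is the target of exactly one relation; its term there cancels the terms from the
    relations at the level of [f], summed by [sum_wirtinger_src]. *)
Lemma row_weight_ker (f : cl_edge w) :
  \sum_(e : cl_edge w) row_weight e * rel_coef e f = 0.
Proof.
under eq_bigr do rewrite row_weight_rel_coef.
rewrite sumrB -big_distrr /=.
have [p pK Kp] := injF_bij (@cl_next_inj w).
rewrite (bigD1 (p f)) //= Kp eqxx big1 => [|e /negPf ef]; last first.
  by rewrite -{1}(Kp f) (inj_eq (@cl_next_inj w)) ef.
apply/eqP; rewrite subr_eq0 addr0 mulr1 -(pair_bigA _ (fun k i =>
  (k == f.1)%:R * wirtinger_src (onth w k) i f.2)) /=.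
rewrite (bigD1 f.1) //= eqxx [X in _ + X]big1 => [|k /negPf ->]; last first.
  by rewrite big1 // => i _; rewrite mul0r.
by rewrite addr0; under eq_bigr do rewrite mul1r; rewrite sum_wirtinger_src.
Qed.

Let A := alexander_mx K.

Lemma alexander_mxE i j : A i j = rel_coef (enum_val i) (enum_val j).
Proof. by rewrite mxE. Qed.

Lemma row_weight_X (e : cl_edge w) : exists k, row_weight e = 'X^k.
Proof. by rewrite /row_weight; case: cl_under => [[o []]|]; eexists. Qed.

Lemma alexander_cofactor_row (i k j : 'I_#|edge K|) :
  row_weight (enum_val k) * cofactor A i j
  = row_weight (enum_val i) * cofactor A k j.
Proof.
pose v : 'cV[{poly int}]_#|edge K| := \col_l row_weight (enum_val l).
have v0 : v != 0.
  apply/eqP => /matrixP/(_ i 0); rewrite !mxE.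
  by have [p ->] := row_weight_X (enum_val i);
  move/eqP; rewrite -size_poly_eq0 size_polyXn.
have := @cofactor_ker _ _ A^T v j i k v0.
rewrite !mxE !cofactor_tr; apply.
apply/matrixP => a b; rewrite !mxE.
under eq_bigr do rewrite !mxE mulrC.
by rewrite -(big_enum_val (A := edge K)
  (fun e => row_weight e * rel_coef e (enum_val a))) row_weight_ker.
Qed.

Lemma alexander_cofactor_col (i j k : 'I_#|edge K|) :
  cofactor A i j = cofactor A i k.
Proof.
have v0 : const_mx 1 != 0 :> 'cV[{poly int}]_#|edge K|.
  by apply/eqP => /matrixP/(_ i 0)/eqP; rewrite !mxE oner_eq0.
have := cofactor_ker _ _ A _ i j k v0 (alexander_mx_row_sum K).
by rewrite !mxE !mul1r.
Qed.

(** Moving the deleted column preserves the cofactor, and moving the deleted row multiplies it by a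
    unit, a power of t. *)
Lemma laurent_dvd_minor i0 j0 i j :
  laurent_dvd (\det (row' i0 (col' j0 A))) (\det (row' i (col' j A))).
Proof.
have [a ua] := row_weight_X (enum_val i0).
have [b ub] := row_weight_X (enum_val i).
have := alexander_cofactor_row i i0 j0.
rewrite (alexander_cofactor_col i j0 j) ua ub /cofactor => E.
exists a, ((-1) ^+ (i + j) * 'X^b * (-1) ^+ (i0 + j0)).
by rewrite -!mulrA -E mulrCA signrMK mulrC.
Qed.

(** The sign is -1 exactly under a negative crossing, where the target edge has coefficient t in its
    relation. *)
Lemma rel_coef_m1 (e f : cl_edge w) : (rel_coef e f).[-1] =
  (if cl_under e is Some (_, false) then -1 else 1) *
  ((cl_next e == f)%:R - ((cl_next e).1 == ordS f.1)%:R *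
    nth 1%:M (map fox_colour_mx w) f.1 (cl_next e).2 f.2).
Proof.
case: e f => k i [k' j].
rewrite /rel_coef /wirtinger /= (inj_eq (@ordS_inj _)).
have edge_eqE a b c d :
  ((a, b) == (c, d) :> edge K) = (a == c) && (b == d) by exact: xpair_eqE.
have -> : nth 1%:M (map fox_colour_mx w) k' =
    if onth w k' is Some l then fox_colour_mx l else 1%:M.
  by rewrite -odflt_onth onth_map; case: onth.
case: (eqVneq k k') => [<-|kk']; rewrite /cl_under /=; last first.
  rewrite mul0r subr0; case: (onth w k) => [[c []]|]; last 1 first.
  - by rewrite /= !edge_eqE (negPf kk') ?xpair_eqE !(hornerE, hornerMn); ring.
  - case: ifP => _; rewrite /= !edge_eqE (negPf kk') ?xpair_eqE /=;
    rewrite !(hornerE, hornerMn); ring.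
  - case: ifP => _; rewrite /= !edge_eqE (negPf kk') ?xpair_eqE /=;
    rewrite !(hornerE, hornerMn); ring.
rewrite mul1r; case: (onth w k) => [[c []]|]; last first.
- by rewrite /= !edge_eqE eqxx ?xpair_eqE mxE !(hornerE, hornerMn) /=; ring.
- rewrite mxE tpermK /fox_colour_src /=; case: (eqVneq i (lstrand c)) => [->|_];
  by rewrite /= !edge_eqE eqxx ?xpair_eqE /= !(hornerE, hornerMn); ring.
rewrite mxE tpermK /fox_colour_src /=; case: (eqVneq i (rstrand c)) => [->|_];
by rewrite /= !edge_eqE eqxx ?xpair_eqE /= !(hornerE, hornerMn); ring.
Qed.

Let top0 : edge K := (ord_max, ord0).
Let bot0 : edge K := (ord0, ord0).

Let A1 := map_mx (horner_eval (-1)) A.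

Let det_A1 : \det A1 = 0.
Proof.
have -> : \det A1 = (\det A).[-1] by rewrite det_map_mx.
suff -> : \det A = 0 by rewrite horner0.
rewrite -det_tr; apply/eqP/det0P; exists (const_mx 1).
  by apply/eqP => /matrixP/(_ 0 (enum_rank top0))/eqP; rewrite !mxE oner_eq0.
apply: trmx_inj; rewrite trmx_mul trmxK trmx_const trmx0.
by rewrite alexander_mx_row_sum.
Qed.

(** No crossing follows the last level, so its weights are 1, t, t^2, with values 1, -1, 1 at t =
    -1. *)
Let A1_cofactor (a : 'I_3) :
  cofactor A1 (enum_rank (ord_max, a)) (enum_rank bot0)
  = (-1) ^+ a * cofactor A1 (enum_rank top0) (enum_rank bot0).
Proof.
have weight_top b : row_weight (ord_max, b) = 'X^b.
  by rewrite /row_weight /cl_under /cl_next /= onth_default.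
have := alexander_cofactor_row (enum_rank (ord_max, a)) (enum_rank top0)
  (enum_rank bot0).
rewrite !enum_rankK !weight_top mul1r => E.
by rewrite !cofactor_map_mx E rmorphM /= /horner_eval hornerXn.
Qed.

(** Since [A1] is singular, perturbing one column turns a minor into a full determinant, to which
    [absz_det_cyclic] applies with the perturbation as [C]. *)
Lemma minor_m1_chain :
  `|(\det (row' (enum_rank top0) (col' (enum_rank bot0) A))).[-1]|%N
  = `|\det (1%:M + \matrix_(i, j) (j == ord0)%:R
            - chain (map fox_colour_mx w))|%N.
Proof.
rewrite -(absz_det_cyclic (N := size w)) ?size_map //.
set c := cofactor A1 (enum_rank top0) (enum_rank bot0).
have -> : `|(\det (row' (enum_rank top0) (col' (enum_rank bot0) A))).[-1]|%N
    = `|c|%N.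
  rewrite /c /cofactor abszM abszX exp1n mul1n -map_col' -map_row'.
  by rewrite det_map_mx.
(* Adding 1 to the three entries of column bot0 at the last level adds to the
   determinant the cofactors c, -c and c. *)
pose M := \matrix_(i, j) (A1 i j
  + (((enum_val i).1 == ord_max) && (j == enum_rank bot0))%:R).
have -> : c = \det M.
  rewrite (expand_det_col M (enum_rank bot0)).
  have cofM i : cofactor M i (enum_rank bot0) = cofactor A1 i (enum_rank bot0).
    rewrite /cofactor; congr (_ * \det _); apply/matrixP => a b.
    by rewrite !mxE [_ == enum_rank _]eq_sym (negPf (neq_lift _ _)) andbF addr0.
  under eq_bigr do rewrite cofM mxE mulrDl eqxx andbT.
  rewrite big_split -expand_det_col /= det_A1 add0r.
  rewrite (eq_bigr (fun i => (fun e : cl_edge w => (e.1 == ord_max)%:R *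
    cofactor A1 (enum_rank e) (enum_rank bot0)) (enum_val i))); last first.
    by move=> i _; rewrite /= enum_valK.
  rewrite (sum_enum_val_pair _ _ _ (fun e : cl_edge w =>
    (e.1 == ord_max)%:R * cofactor A1 (enum_rank e) (enum_rank bot0))) /=.
  rewrite (bigD1 ord_max) //= eqxx.
  rewrite [X in _ + X]big1 => [|k /negPf ->]; last first.
    by rewrite big1 // => i _; rewrite mul0r.
  rewrite addr0; under eq_bigr do rewrite mul1r A1_cofactor.
  by rewrite -/c !big_ord_recl big_ord0 /= /bump /=; ring.
(* Indexing each relation by its target edge turns the system into the cyclic one, up to the signs
   of the rows. *)
pose next_rank (i : 'I_#|edge K|) := enum_rank (cl_next (enum_val i) : edge K).
have next_rank_inj : injective next_rank.
  by move=> i j /enum_rank_inj/cl_next_inj/enum_val_inj.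
pose sgn (e : cl_edge w) : int :=
  if cl_under e is Some (_, false) then -1 else 1.
set Z := \matrix_(i, j) cyclic_coef _ _ _ _.
have -> : M = diag_mx (\row_i sgn (enum_val i)) *m
    row_perm (perm next_rank_inj) Z.
  rewrite mul_diag_mx; apply/matrixP => i j.
  rewrite [LHS]mxE [A1 i j]mxE alexander_mxE !mxE permE enum_rankK.
  rewrite /horner_eval rel_coef_m1 -/(sgn _) /cyclic_coef.
  rewrite [in RHS]mulrDr; congr (_ + _).
  rewrite -(inj_eq enum_val_inj) enum_rankK.
  case: (enum_val i) (enum_val j) => k a [l b].
  have -> : ((l, b) == bot0) = (l == ord0) && (b == ord0) by exact: xpair_eqE.
  (* Relations of the last level have their targets at level 0, so the perturbed rows become the
     rows where [C] sits. *)
  have ord0E : ord0 = ordS (@ord_max (size w)).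
    by apply: val_inj; rewrite /= modnn.
  rewrite mxE /= [in RHS]ord0E (inj_eq (@ordS_inj _)) -ord0E.
  case: eqVneq => [->|_] /=; last by rewrite mul0r mulr0.
  by rewrite /sgn /cl_under /= onth_default // mul1r -natrM mulnb.
rewrite det_mulmx abszM det_diag row_permE det_mulmx abszM det_perm abszX exp1n.
rewrite mul1n -[RHS]mul1n; congr (_ * _)%N.
apply: (big_ind (fun x : int => `|x|%N = 1%N)) => // [x y x1 y1|i _].
  by rewrite abszM x1 y1.
by rewrite mxE /sgn; case: cl_under => [[? []]|].
Qed.
End Closure.

(** * The reduced Burau representation *)

Lemma chain_cat d (s t : seq 'M[int]_d) : chain (s ++ t) = chain t *m chain s.
Proof.
elim/last_ind: t => [|t A IHt]; first by rewrite cats0 mul1mx.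
by rewrite -rcons_cat /chain !foldl_rcons -!/(chain _) IHt mulmxA.
Qed.

Lemma chain_rcons d (s : seq 'M[int]_d) A : chain (rcons s A) = A *m chain s.
Proof. by rewrite /chain foldl_rcons. Qed.

Lemma det_mx22 (R : comNzRingType) (A : 'M[R]_2) :
  \det A = A ord0 ord0 * A ord_max ord_max - A ord0 ord_max * A ord_max ord0.
Proof.
pose a i j := A (inord i) (inord j).
have aE i j : A i j = a i j by rewrite /a !inord_val.
rewrite (expand_det_row _ ord0) !big_ord_recl big_ord0 /cofactor !det_mx11 !mxE.
by rewrite !aE /= /bump /=; ring.
Qed.

Lemma mxtrace22 (R : comNzRingType) (A : 'M[R]_2) :
  \tr A = A ord0 ord0 + A ord_max ord_max.
Proof.
rewrite /mxtrace !big_ord_recl big_ord0 addr0; congr (_ + A _ _);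
exact: val_inj.
Qed.

Lemma det_mx33 (R : comNzRingType) (a : nat -> nat -> R) :
  \det (\matrix_(i < 3, j < 3) a i j)
  = a 0%N 0%N * (a 1%N 1%N * a 2%N 2%N - a 1%N 2%N * a 2%N 1%N)
  - a 0%N 1%N * (a 1%N 0%N * a 2%N 2%N - a 1%N 2%N * a 2%N 0%N)
  + a 0%N 2%N * (a 1%N 0%N * a 2%N 1%N - a 1%N 1%N * a 2%N 0%N).
Proof.
rewrite (expand_det_row _ ord0) !big_ord_recl big_ord0 /cofactor !det_mx22 !mxE.
by rewrite /= /bump /=; ring.
Qed.

(* Differences of the colours of adjacent strands: these coordinates split off
   the trivial summand of the unreduced Burau representation. *)
Definition diff_mx : 'M[int]_(2, 3) :=
  \matrix_(i, j) ((j == i :> nat)%:R - (j == i.+1 :> nat)%:R).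

Definition burau_mx (l : letter) : 'M[int]_2 :=
  let e := if l.2 then 1 else -1 in
  if l.1 == 0 then 1%:M + e *: delta_mx 1 0 else 1%:M - e *: delta_mx 0 1.

Lemma diff_fox_colour l : diff_mx *m fox_colour_mx l = burau_mx l *m diff_mx.
Proof.
case: l => [[[|[|c]] hc] []] //;
apply/matrixP => -[[|[|i]] hi] // [[|[|[|j]]] hj] //;
by rewrite !mxE !big_ord_recl !big_ord0 /burau_mx /= !mxE /fox_colour_src /=
  -!val_eqE /= !val_tperm.
Qed.

Lemma fox_colour_const l : fox_colour_mx l *m const_mx 1 = const_mx 1 :> 'cV_3.
Proof.
case: l => [[[|[|c]] hc] []] //; apply/matrixP => -[[|[|[|i]]] hi] // j;
by rewrite !mxE !big_ord_recl !big_ord0 /= !mxE /fox_colour_src /=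
  -!val_eqE /= !val_tperm.
Qed.

Definition burau (w : word) : 'M[int]_2 := chain (map burau_mx w).

(** In the coordinates x0, x0 - x1, x1 - x2 the transport matrix is block triangular with diagonal
    blocks 1 and H. The added matrix sends x to x0 times the all-ones vector, so it only replaces
    the zero block of 1 - T by 1. *)
Lemma det_fox_colour_burau w :
  \det (1%:M + \matrix_(i, j) (j == ord0)%:R - chain (map fox_colour_mx w))
  = \det (1%:M - burau w).
Proof.
have QT : diff_mx *m chain (map fox_colour_mx w) = burau w *m diff_mx.
  rewrite /burau; elim/last_ind: w => [|w l IHw].
    by rewrite mulmx1 mul1mx.
  by rewrite !map_rcons !chain_rcons mulmxA diff_fox_colour -!mulmxA IHw.
have T1 : chain (map fox_colour_mx w) *m const_mx 1 = const_mx 1 :> 'cV_3.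
  elim/last_ind: w {QT} => [|w l IHw]; first by rewrite mul1mx.
  by rewrite !map_rcons !chain_rcons -mulmxA IHw fox_colour_const.
move: (chain _) (burau w) QT T1 => T H QT T1.
pose t i j := T (inord i) (inord j).
pose h i j := H (inord i) (inord j).
have tE i j : T i j = t i j by rewrite /t !inord_val.
have hE i j : H i j = h i j by rewrite /h !inord_val.
have -> : 1%:M + \matrix_(i, j) (j == ord0)%:R - T =
    \matrix_(i < 3, j < 3) ((i == j :> nat)%:R + (j == 0 :> nat)%:R - t i j).
  by apply/matrixP => i j; rewrite !mxE -tE.
(* Both hypotheses together express the last column of [T] and all of [H] through the first two
   columns of [T]; the claim is then a polynomial identity. *)
have row (i : 'I_3) : t i 2%N = 1 - t i 0%N - t i 1%N.
  move/matrixP/(_ i 0): T1; rewrite !mxE !big_ord_recl big_ord0 !mxE !tE.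
  by rewrite !mulr1 addr0 => <-; rewrite /= /bump /=; ring.
have col (i : 'I_2) (j : 'I_3) : t i j - t i.+1 j
    = h i 0%N * ((j == 0%N :> nat)%:R - (j == 1%N :> nat)%:R)
      + h i 1%N * ((j == 1%N :> nat)%:R - (j == 2%N :> nat)%:R).
  move/matrixP/(_ i j): QT; rewrite !mxE !big_ord_recl !big_ord0 !mxE !tE !hE.
  rewrite /= /bump /= !addr0 => <-.
  by case: i => -[|[|i]] //= _; ring.
have h0 (i : 'I_2) : h i 0%N = t i 0%N - t i.+1 0%N.
  by rewrite (col i ord0) /=; ring.
have h1 (i : 'I_2) : h i 1%N = h i 0%N + t i 1%N - t i.+1 1%N.
  by have := col i (inord 1); rewrite inordK //= -addrA => ->; ring.
rewrite (det_mx33 _ (fun i j => (i == j)%:R + (j == 0%N)%:R - t i j)).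
rewrite det_mx22 !mxE !hE.
rewrite !(h1 ord0) !(h1 ord_max) !(h0 ord0) !(h0 ord_max) /=.
have := row (inord 1); rewrite inordK // => row1.
rewrite (row ord0) row1 (row ord_max) /=.
ring.
Qed.

Lemma matrix2P (R : nmodType) (A B : 'M[R]_2) :
  A ord0 ord0 = B ord0 ord0 -> A ord0 ord_max = B ord0 ord_max ->
  A ord_max ord0 = B ord_max ord0 -> A ord_max ord_max = B ord_max ord_max ->
  A = B.
Proof.
move=> h00 h01 h10 h11; apply/matrixP => i j.
have ordE (k : 'I_2) : k = ord0 \/ k = ord_max.
  by case: k => [[|[|k]] hk] //; [left|right]; apply: val_inj.
by case: (ordE i) => ->; case: (ordE j) => ->.
Qed.

Lemma mulmx22 (R : comNzRingType) (A B : 'M[R]_2) i j :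
  (A *m B) i j = A i ord0 * B ord0 j + A i ord_max * B ord_max j.
Proof.
rewrite mxE !big_ord_recl big_ord0 addr0.
by congr (_ + A i _ * B _ j); apply: val_inj.
Qed.

Lemma burau_cat u v : burau (u ++ v) = burau v *m burau u.
Proof. by rewrite /burau map_cat chain_cat. Qed.

Lemma burau1 l : burau [:: l] = burau_mx l.
Proof. exact: mulmx1. Qed.

Lemma det_burau w : \det (burau w) = 1.
Proof.
elim: w => [|l w IHw]; first exact: det1.
rewrite -cat1s burau_cat det_mulmx IHw mul1r burau1 det_mx22.
by case: l => [[[|[|c]] hc] []]; rewrite // /burau_mx /= !mxE.
Qed.

Lemma burau_braid_eq u v : braid_eq u v -> burau u = burau v.
Proof.
elim=> // [a b c _ -> _ -> //|a a' b b' _ IHa _ IHb|[[|[|i]] hi] s|].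
- by rewrite !burau_cat IHa IHb.
- by apply: matrix2P; case: s; rewrite -cat1s burau_cat !burau1 mulmx22 !mxE.
- by apply: matrix2P; case: s; rewrite -cat1s burau_cat !burau1 mulmx22 !mxE.
- by [].
by apply: matrix2P; rewrite /burau /chain /= !mulmx22 !mxE.
Qed.

Definition burau_B3 (b : B3) : 'M[int]_2 :=
  burau (repr (b : {eq_quot braid_equiv}%qT)).

Lemma burau_B3E w : burau_B3 (braid_of_word w) = burau w.
Proof. exact/burau_braid_eq/repr_braid_of_word. Qed.

Lemma burau_B3M a b : burau_B3 (a * b)%g = burau_B3 b *m burau_B3 a.
Proof. by rewrite [LHS]burau_B3E burau_cat. Qed.

Lemma burau_B31 : burau_B3 1%g = 1%:M.
Proof. exact: burau_B3E. Qed.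

Lemma burau_B3X a n : burau_B3 (a ^+ n)%g = burau_B3 a ^+ n.
Proof.
elim: n => [|n IHn]; first exact: burau_B31.
by rewrite expgS burau_B3M IHn exprSr.
Qed.

(** For a 2 x 2 matrix, det(1 - H) = 1 - tr H + det H, and here det H = 1. *)
Lemma link_det_closure b K : is_closure b K ->
  link_det K = `|2 - \tr (burau_B3 b)|%N.
Proof.
case=> w <- ->; rewrite burau_B3E.
rewrite (link_det_minor _ _ _ (laurent_dvd_minor w (enum_rank (ord_max, ord0))
  (enum_rank (ord0, ord0)))).
rewrite minor_m1_chain det_fox_colour_burau; congr (`|_|%N).
have := det_burau w; rewrite !det_mx22 mxtrace22 !mxE /= => e.
transitivity (1 - burau w ord0 ord0 - burau w ord_max ord_max
  + (burau w ord0 ord0 * burau w ord_max ord_max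
     - burau w ord0 ord_max * burau w ord_max ord0)); first by ring.
by rewrite e; ring.
Qed.

(** * Weaving braids, full twists and Lucas numbers *)

Definition weaving_mx (m : nat) : 'M[int]_2 :=
  (1%:M + m%:R *: delta_mx ord0 ord_max) *m
  (1%:M + m%:R *: delta_mx ord_max ord0).

Lemma burau_sigma1X m :
  burau_B3 (sigma1 ^+ m)%g = 1%:M + m%:R *: delta_mx ord_max ord0.
Proof.
rewrite burau_B3X burau_B3E burau1; elim: m => [|m IHm].
  by rewrite expr0 scale0r addr0.
rewrite exprS IHm.
by apply: matrix2P; rewrite [LHS]mulmx22 /burau_mx /= !mxE /= -natr1; ring.
Qed.

Lemma burau_sigma2V m :
  burau_B3 (sigma2 ^- m)%g = 1%:M + m%:R *: delta_mx ord0 ord_max.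
Proof.
have -> : (sigma2 ^- m = braid_of_word [:: (ord_max, false)] ^+ m)%g.
  rewrite -expVgn; congr (_ ^+ _)%g.
  rewrite -[RHS](mulKg sigma2) -[X in (_ * X)%g]braid_of_word_cat.
  have /braid_of_wordP -> := braid_cancel ord_max true.
  exact: esym (mulg1 _).
rewrite burau_B3X burau_B3E burau1; elim: m => [|m IHm].
  by rewrite expr0 scale0r addr0.
rewrite exprS IHm.
by apply: matrix2P; rewrite [LHS]mulmx22 /burau_mx /= !mxE /= -natr1; ring.
Qed.

Lemma burau_weaving m n :
  burau_B3 ((expgz sigma1 m%:Z * expgz sigma2 (- m%:Z)) ^+ n)%g
  = weaving_mx m ^+ n.
Proof.
rewrite burau_B3X burau_B3M burau_sigma1X; congr ((_ *m _) ^+ _).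
(* [expgz] branches on the constructor of the exponent, and [- m%:Z] is a [Posz] only for m = 0. *)
case: m => [|m]; last exact: burau_sigma2V.
by rewrite oppr0 [LHS]burau_B31 scale0r addr0.
Qed.

(** The image of sigma1 sigma2 has cube -1, which is its own inverse, so both values of [l] give the
    same matrix. *)
Lemma burau_full_twist l : l = 1 \/ l = -1 ->
  burau_B3 (expgz (sigma1 * sigma2)%g (3 * l)%R) = - 1%:M.
Proof.
have twist : burau_B3 ((sigma1 * sigma2) ^+ 3)%g = - 1%:M.
  rewrite burau_B3X burau_B3M !burau_B3E !burau1 !exprS expr0 mulr1.
  by apply: matrix2P; rewrite !(mulmx22, mxE).
case=> ->; first exact: twist.
have := burau_B31; rewrite -(mulgV ((sigma1 * sigma2) ^+ 3)%g) burau_B3M twist.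
by rewrite mulmxN mulmx1 => /(canRL opprK).
Qed.

(** Cayley-Hamilton for a matrix of trace m^2 + 2 and determinant 1. *)
Lemma trace_weavingSS m n :
  \tr (weaving_mx m ^+ n.+2)
  = (m%:R ^+ 2 + 2) * \tr (weaving_mx m ^+ n.+1) - \tr (weaving_mx m ^+ n).
Proof.
have cayley : weaving_mx m * weaving_mx m
    = (m%:R ^+ 2 + 2) *: weaving_mx m - 1%:M.
  by apply: matrix2P; rewrite [LHS]mulmx22 /weaving_mx !(mulmx22, mxE) /=; ring.
rewrite 2!exprSr -mulrA cayley mulrBr mulr1 -scalerAr.
by rewrite raddfB /= mxtraceZ -exprSr.
Qed.

Lemma trace_weaving0 m : \tr (weaving_mx m ^+ 0) = 2.
Proof. by rewrite expr0 mxtrace1. Qed.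

Lemma trace_weaving1 m : \tr (weaving_mx m ^+ 1) = m%:R ^+ 2 + 2.
Proof.
by rewrite expr1 mxtrace22 /weaving_mx !mulmx22 !mxE /=; ring.
Qed.

(** Both sides obey the same second-order recurrence, with equal values at 0 and 1. *)
Lemma trace_weaving (R : realType) m n :
  (\tr (weaving_mx m ^+ n))%:~R = lucas R m (2 * n).
Proof.
set f := Phi R m.
have disc_ge0 : 0 <= m%:R ^+ 2 + 4 :> R by rewrite addr_ge0 ?sqr_ge0.
have f_gt0 : 0 < f.
  by rewrite divr_gt0 // ltr_wpDl ?sqrtr_gt0 // ltr_wpDl ?sqr_ge0.
(* Phi is a root of x^2 = m x + 1. *)
have fV : f^-1 = f - m%:R.
  apply: (mulIf (lt0r_neq0 f_gt0)); rewrite mulVf ?lt0r_neq0 // /f /Phi.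
  by have := sqr_sqrtr disc_ge0; move: (Num.sqrt _) => s s2; lra.
have lucasE k : lucas R m (2 * k) = (f ^+ 2) ^+ k + (f^-1 ^+ 2) ^+ k.
  by rewrite /lucas !exprM sqrrN.
have ff1 : f * f^-1 = 1 by rewrite mulfV ?lt0r_neq0.
have sumE : f ^+ 2 + f^-1 ^+ 2 = m%:R ^+ 2 + 2.
  transitivity ((f - f^-1) ^+ 2 + 2 * (f * f^-1)); first by ring.
  by rewrite ff1 fV; ring.
have lucasSS k : lucas R m (2 * k.+2)
    = (m%:R ^+ 2 + 2) * lucas R m (2 * k.+1) - lucas R m (2 * k).
  rewrite !lucasE -sumE.
  have : f ^+ 2 * f^-1 ^+ 2 = 1 by rewrite -exprMn ff1 expr1n.
  move: (f ^+ 2) (f^-1 ^+ 2) => a b ab.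
  rewrite !exprS; transitivity (a * (a * a ^+ k) + b * (b * b ^+ k)
    + (a * b - 1) * (a ^+ k + b ^+ k)); last by ring.
  by rewrite ab subrr mul0r addr0.
suff [] : (\tr (weaving_mx m ^+ n))%:~R = lucas R m (2 * n) /\
  (\tr (weaving_mx m ^+ n.+1))%:~R = lucas R m (2 * n.+1) by [].
elim: n => [|n [IHn IHn1]]; split=> //.
- by rewrite trace_weaving0 lucasE !expr0.
- by rewrite trace_weaving1 lucasE !expr1 sumE !rmorphD rmorphXn /= natz.
rewrite trace_weavingSS lucasSS rmorphB rmorphM /= IHn IHn1.
by rewrite rmorphD rmorphXn /= natz.
Qed.

(** This settles the signs inside the absolute values of the link determinants. The induction also
    carries the monotonicity of the traces. *)
Lemma trace_weaving_ge2 m n : 2 <= \tr (weaving_mx m ^+ n).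
Proof.
suff /andP[] : 2 <= \tr (weaving_mx m ^+ n) <= \tr (weaving_mx m ^+ n.+1) by [].
elim: n => [|n /andP[t2 tS]].
  by rewrite trace_weaving0 trace_weaving1 lexx lerDr sqr_ge0.
rewrite trace_weavingSS (le_trans t2 tS) /=.
have : 0 <= m%:R ^+ 2 :> int by exact: sqr_ge0.
move: (m%:R ^+ 2) (\tr _) (\tr _) t2 tS => x t u t2 tS x0; nia.
Qed.

Theorem corollary2 (R : realType) (m n : nat) (m_gt0 : (0 < m)%N)
    (n_gt0 : (0 < n)%N) :
  (forall K : diagram, is_closure (W3 m n) K ->
     (link_det K)%:R = lucas R m (2 * n) - 2) /\
  (forall (l : int) (K : diagram), l = 1 \/ l = -1 ->
     is_closure (Q3 m%:Z (- m%:Z) n l) K ->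
     (link_det K)%:R = lucas R m (2 * n) + 2).
Proof.
have ge2 := trace_weaving_ge2 m n.
rewrite -trace_weaving; split=> [K|l K l1] /link_det_closure ->.
  rewrite burau_B3M burau_weaving burau_B31 mul1mx natr_absz.
  by rewrite distrC ger0_norm ?subr_ge0 // rmorphB.
(* The full twist negates the trace, so 2 - tr becomes 2 + tr. *)
rewrite burau_B3M burau_weaving burau_full_twist // mulNmx mul1mx.
rewrite natr_absz raddfN opprK ger0_norm ?addr_ge0 // ?(le_trans _ ge2) //.
by rewrite rmorphD addrC.
Qed.
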